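(* There is no subset $S\subseteq\mathbb{F}_{13}^{2}$ with $|S|=52$ for which exactly four affine directions are special.
   Context: $\mathbb{F}_{13}$ is the field with $13$ elements, and $\mathbb{F}_{13}^2$ is the affine plane over it. An affine direction is a parallel class of affine lines of $\mathbb{F}_{13}^2$; there are fourteen directions (the slopes $m\in\mathbb{F}_{13}$, with lines $y-mx=\text{const}$, and the vertical direction $\infty$, with lines $x=\text{const}$), and each direction partitions the plane into thirteen parallel lines. For a subset $S\subseteq\mathbb{F}_{13}^2$, a direction is called special for $S$ if the thirteen numbers $|S\cap\ell|$, with $\ell$ running over the thirteen lines of that direction, are not all equal. *)

(* Defs.v *)
From mathcomp Require Import all_boot all_order all_algebra.

Set Implicit Arguments.
Unset Strict Implicit.
Unset Printing Implicit Defensive.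

Import GRing.Theory.
Local Open Scope ring_scope.

Notation plane := ('F_13 * 'F_13)%type.

(* [Some m] is the slope m, [None] the vertical slope. *)
Definition line (d : option 'F_13) (c : 'F_13) : {set plane} :=
  match d with
  | Some m => [set p : plane | p.2 - m * p.1 == c]
  | None => [set p : plane | p.1 == c]
  end.

Definition parallel_class (d : option 'F_13) : {set {set plane}} :=
  [set line d c | c : 'F_13].

Definition directions : {set {set {set plane}}} :=
  [set parallel_class d | d : option 'F_13].

Definition special (S : {set plane}) (D : {set {set plane}}) : bool :=
  ~~ [forall l1 in D, forall l2 in D, #|S :&: l1| == #|S :&: l2|].

Definition special_directions (S : {set plane}) : {set {set {set plane}}} :=
  [set D in directions | special S D].

(* Main.v *)
Require Import Defs.
From mathcomp Require Import all_boot all_order all_algebra.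
From mathcomp Require Import ring.

Set Implicit Arguments.
Unset Strict Implicit.
Unset Printing Implicit Defensive.

Import GRing.Theory.
Local Open Scope ring_scope.

(** Write n_d(c) for the number of points of S on the line of direction d and
    level c. Counting the pairs (point of S, direction joining it to p) shows
    that the fourteen lines through p carry |S| + 13 [p in S] points of S in
    total ([sum_counts_through]). Ten directions contribute 4 each, so the
    four special ones satisfy

      n_1(l_1(p)) + ... + n_4(l_4(p)) = 12 (mod 13)   for every point p,

    where l_1, ..., l_4 are pairwise independent linear forms. A constant sum
    of four functions of such forms is rigid: differencing along the kernel of
    l_j kills the j-th summand and differences the others, so that the
    third difference of each n_i vanishes modulo 13 ([iter_diff_ridge]). Hence n_i is
    congruent to a polynomial of degree at most two in the level.

    The size of S now bounds the residues: those of n_i add up to at most 52.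
    - If n_i is affine, it is constant modulo 13, because the residues of a
      nonconstant affine function add up to 78; since n_i is not constant and
      at most 13, that constant is 0. With one summand gone, two differences
      kill each of the other three, so these are affine as well, hence all
      four vanish modulo 13 and cannot add up to 12.
    - Otherwise n_i(t) = a_i (t - m_i)^2 + k_i with a_i nonzero for all i, and
      the bound on the residues forces k_i to be 4 or 8
      ([quadratic_constant_term]). The axes of symmetry are concurrent: the
      point p0 with l_1(p0) = m_1 and l_2(p0) = m_2 satisfies l_i(p0) = m_i
      for all i, because reflecting the relation in p0 and subtracting leaves
      a relation between two functions only. So at p0 four numbers, each equal
      to 4 or 8, add up to 12 modulo 13. But these sums are
      16, 20, 24, 28, 32, that is 3, 7, 11, 2, 6. *)

(** * Functions of several linear forms with vanishing sum *)

Section RidgeSums.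

Variable F : finFieldType.
Implicit Types (d e : option F) (p v : F * F) (f : F -> F).

(** The level of [p] in direction [d]: the lines of direction [d] are the level
    sets of this linear form. *)
Definition form d p : F := if d is Some m then p.2 - m * p.1 else p.1.

Lemma formD d p v : form d (p + v) = form d p + form d v.
Proof. by case: d => [m|] //=; ring. Qed.

Lemma formN d p : form d (- p) = - form d p.
Proof. by case: d => [m|] //=; ring. Qed.

Lemma exists_other_direction d : exists e, d != e.
Proof. by case: d => [m|]; [exists None | exists (Some 0)]. Qed.

Lemma exists_point d e (a b : F) :
  d != e -> exists2 p, form d p = a & form e p = b.
Proof.
case: d e => [m|] [k|] //= neq.
- have mk : k - m != 0.
    by rewrite subr_eq0; apply: contraNneq neq => ->.
  exists ((a - b) / (k - m), a + m * ((a - b) / (k - m))) => /=; first by ring.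
  by field.
- by exists (b, a + m * b) => //=; ring.
- by exists (a, b + k * a) => //=; ring.
Qed.

Lemma form_inj d e p v :
  d != e -> form d p = form d v -> form e p = form e v -> p = v.
Proof.
case: p v => [x y] [z t]; case: d e => [m|] [k|] //= neq.
- move=> Em Ek.
  have mk : k - m != 0.
    by rewrite subr_eq0; apply: contraNneq neq => ->.
  have xz : x = z.
    apply: (mulfI mk); transitivity ((y - m * x) - (y - k * x)); first by ring.
    by rewrite Em Ek; ring.
  by move: Em; rewrite xz => /addIr ->.
- by move=> Em xz; move: Em; rewrite xz => /addIr ->.
- by move=> xz; rewrite xz => /addIr ->.
Qed.

Lemma card_joining_directions p v :
  #|[set d | form d p == form d v]| = if p == v then #|F|.+1 else 1%N.
Proof.
have [->|neq] := eqVneq p v.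
  by rewrite (eq_card (B := predT)) ?card_option // => d; rewrite !inE eqxx.
have [d Ed] : exists d, form d p = form d v.
  have [xz|xz] := eqVneq p.1 v.1; first by exists None.
  exists (Some ((p.2 - v.2) / (p.1 - v.1))) => /=.
  by field; rewrite subr_eq0.
apply/eqP/cards1P; exists d; apply/setP => e; rewrite !inE.
apply/eqP/eqP => [Ee|-> //].
apply/eqP; apply: contraNT neq => ne; apply/eqP.
exact: form_inj ne Ee Ed.
Qed.

Definition diff f t := f (t + 1) - f t.

(** Translating by a vector [v] with [form e v = 0] and [form d v = 1] and
    subtracting removes the summand of [e], replaces [f] by [diff f], and turns
    each other summand into another function of the same form. Doing this once
    for each [e] in [A] leaves only the iterated difference of [f]. *)
Lemma iter_diff_ridge n (A : {set option F}) d f (g : option F -> F -> F) :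
    #|A| = n -> d \notin A ->
    (forall p, f (form d p) + \sum_(e in A) g e (form e p) = 0) ->
  forall t, iter n diff f t = 0.
Proof.
elim: n A f g => [|n IHn] A f g cardA dA fg0 t /=.
  have [e de] := exists_other_direction d.
  have [p <- _] := exists_point t 0 de.
  by have := fg0 p; rewrite (cards0_eq cardA) big_set0 addr0.
have [e eA] : exists e, e \in A by apply/card_gt0P; rewrite cardA.
have de : d != e by apply: contraNneq dA => ->.
have [v dv ev] := exists_point 1 0 de.
rewrite -iterS iterSr.
pose g' c s := g c (s + form c v) - g c s.
apply: (IHn (A :\ e) _ g') => [||p].
- by move: cardA; rewrite (cardsD1 e) eA => -[].
- by rewrite !inE negb_and dA orbT.
have E : f (form d (p + v)) + \sum_(c in A) g c (form c (p + v))
       - (f (form d p) + \sum_(c in A) g c (form c p)) = 0.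
  by rewrite !fg0 subrr.
rewrite -[RHS]E !(big_setD1 e eA) /= !formD dv ev addr0.
under [X in _ + X = _]eq_bigr => c _ do rewrite /g' -formD.
by rewrite sumrB /diff; ring.
Qed.

End RidgeSums.

Arguments diff {F} f t.

(** * Functions on the prime field: differences and residues *)

Lemma diff0_const (f : 'F_13 -> 'F_13) :
  (forall t, diff f t = 0) -> forall t, f t = f 0.
Proof.
move=> f0 t; rewrite -(natr_Zp t).
elim: (t : nat) => [//|n IHn].
by rewrite -natr1 -[RHS]IHn; apply/eqP; rewrite -subr_eq0; apply/eqP/f0.
Qed.

Lemma diff2_affine (f : 'F_13 -> 'F_13) :
    (forall t, iter 2%N diff f t = 0) ->
  exists b, forall t, f t = b * t + f 0.
Proof.
move=> f0; exists (diff f 0) => t.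
have E1 : forall s, diff f s = diff f 0 by apply: diff0_const.
pose h s := f s - diff f 0 * s.
have /diff0_const/(_ t) : forall s, diff h s = 0.
  move=> s; transitivity (diff f s - diff f 0); last by rewrite E1 subrr.
  by rewrite /diff /h /diff; ring.
by rewrite /h mulr0 subr0 => <-; ring.
Qed.

Lemma diff3_quadratic (f : 'F_13 -> 'F_13) :
    (forall t, iter 3%N diff f t = 0) ->
  exists a b, forall t, f t = a * t ^+ 2 + b * t + f 0.
Proof.
move=> f0.
have [c Ec] : exists b, forall t, diff f t = b * t + diff f 0.
  exact: diff2_affine.
have n2 : (2 : 'F_13) != 0 by [].
pose a := c / 2; exists a, (diff f 0 - a) => t.
have a2 : c = a * 2 by rewrite /a; field.
pose h s := f s - (a * s ^+ 2 + (diff f 0 - a) * s).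
have /diff0_const/(_ t) : forall s, diff h s = 0.
  move=> s; transitivity (diff f s - (c * s + diff f 0)).
    by rewrite a2 /diff /h /diff; ring.
  by rewrite Ec subrr.
by rewrite /h expr0n /= !mulr0 addr0 subr0 => <-; ring.
Qed.

(** The values are all the residues, each taken once. *)
Lemma sum_residues_affine (b c : 'F_13) :
  b != 0 -> (\sum_(t : 'F_13) (b * t + c)%R = 78)%N.
Proof.
move=> b0.
pose h (t : 'F_13) := b * t + c.
rewrite -(reindex_inj (h := h) (F := fun t => nat_of_ord t) (P := predT)) /=.
  by rewrite -(big_mkord predT id) unlock.
by move=> s t /addIr/(mulfI b0).
Qed.

(** Only whether [a] is a square matters for the sum of the residues. It is
    52 if [a] is a square and [c = 4] (values 4; 5, 7, 8, 0, 1, 3 twice each)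
    or [a] is not a square and [c = 8] (values 8; 10, 0, 1, 2, 3, 6 twice each),
    and at least 65 otherwise, which is checked by enumeration. *)
Lemma quadratic_constant_term (a c : 'F_13) :
    a != 0 -> (\sum_(t : 'F_13) (a * t ^+ 2 + c)%R <= 52)%N ->
  c = 4 \/ c = 8.
Proof.
have chk : all (fun i => all (fun k => [|| (i == 0)%N,
    52 < \sum_(0 <= t < 13) ((i * t ^ 2 + k) %% 13), k == 4 | k == 8]%N)
  (iota 0 13)) (iota 0 13).
  by rewrite unlock; vm_compute.
have E : (\sum_(t : 'F_13) (a * t ^+ 2 + c)%R =
          \sum_(0 <= t < 13) (a * t ^ 2 + c) %% 13)%N.
  rewrite big_mkord; apply: eq_bigr => t _ /=.
  by rewrite modnMmr modnDml.
move=> a0; rewrite E leqNgt.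
move/allP/(_ a): chk; rewrite mem_iota ltn_ord => /(_ isT)/allP/(_ c).
rewrite mem_iota ltn_ord => /(_ isT)/or4P [/eqP E0|->//|/eqP E4|/eqP E8] _.
- by case/eqP: a0; apply: val_inj.
- by left; apply: val_inj.
- by right; apply: val_inj.
Qed.

(** * The four special directions *)

(** The counts [n d t] of points of [S] on the lines of the four special
    directions [A] would satisfy these hypotheses; the last one is the relation
    between the four lines through [p], read modulo 13. *)
Lemma no_four_profiles (A : {set option 'F_13})
    (n : option 'F_13 -> 'F_13 -> nat) :
    #|A| = 4%N ->
    (forall d, d \in A -> \sum_t n d t = 52)%N ->
    (forall d t, d \in A -> n d t <= 13)%N ->
    (forall d, d \in A -> ~ forall t u, n d t = n d u) ->
    (forall p : plane, \sum_(d in A) (n d (form d p))%:R = 12 :> 'F_13) ->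
  False.
Proof.
move=> A4 n52 n13 nconst sum12.
pose f d t : 'F_13 := (n d t)%:R.
have fE d t : nat_of_ord (f d t) = (n d t %% 13)%N by rewrite /f val_Fp_nat.
have f52 d : d \in A -> (\sum_t f d t <= 52)%N.
  by move=> /n52 <-; apply: leq_sum => t _; rewrite fE leq_mod.
have affine0 d b c :
  d \in A -> (forall t, f d t = b * t + c) -> forall t, f d t = 0.
  move=> dA fbc.
  have b0 : b = 0.
    apply: contraTeq (f52 d dA) => b0.
    by under eq_bigr => t _ do rewrite fbc; rewrite sum_residues_affine.
  have fc t : f d t = c by rewrite fbc b0 mul0r add0r.
  have [c0|c0] := eqVneq c 0; first by move=> t; rewrite fc.
  case: (nconst d dA) => t u.
  (* The residue class of c <> 0 has a single element in 0, ..., 13. *)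
  suff nc v : n d v = c by rewrite !nc.
  rewrite -(fc v) fE modn_small // ltn_neqAle n13 // andbT.
  apply: contra_neqN c0 => /eqP n13E.
  by rewrite -(fc v) /f n13E; apply: val_inj.
have quad d :
  d \in A -> exists a b, forall t, f d t = a * t ^+ 2 + b * t + f d 0.
  move=> dA; apply: diff3_quadratic => t.
  transitivity (iter 3%N diff (fun t => f d t - 12) t).
    by rewrite /= /diff; ring.
  have A3 : #|A :\ d| = 3%N by move: A4; rewrite (cardsD1 d) dA => -[].
  apply: (iter_diff_ridge (d := d) (g := f) A3) => [|p];
    first by rewrite !inE eqxx.
  by rewrite -(sum12 p) (big_setD1 d dA) /= /f; ring.
have non_affine d : d \in A -> ~ exists b, forall t, f d t = b * t + f d 0.
  move=> dA [b fb]; have fd0 := affine0 d _ _ dA fb.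
  have all0 e t : e \in A -> f e t = 0.
    move=> eA; have [->//|ed] := eqVneq e d.
    have eAd : e \in A :\ d by rewrite !inE ed.
    (* The summand of d vanishes: only two others besides that of e remain. *)
    have [//|c fc] := @diff2_affine (f e) _; last exact: affine0 fc _.
    move=> u; transitivity (iter 2%N diff (fun t => f e t - 12) u).
      by rewrite /= /diff; ring.
    have A2 : #|A :\ d :\ e| = 2%N.
      by move: A4; rewrite (cardsD1 d) dA (cardsD1 e) eAd => -[].
    apply: (iter_diff_ridge (d := e) (g := f) A2) => [|p];
      first by rewrite !inE eqxx.
    rewrite -(sum12 p) (big_setD1 d dA) (big_setD1 e eAd) /=.
    by rewrite -/(f _ _) fd0 /f; ring.
  have := sum12 0; rewrite big1 // => e eA; exact: all0.
have center d :
  d \in A -> exists a m k, a != 0 /\ forall t, f d t = a * (t - m) ^+ 2 + k.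
  move=> dA; have [a [b fab]] := quad d dA.
  have a0 : a != 0.
    apply/eqP => a0; apply: (non_affine d dA); exists b => t.
    by rewrite fab a0 mul0r add0r.
  exists a, (- b / (2 * a)), (f d 0 - b ^+ 2 / (4 * a)); split => // t.
  have n2 : (2 : 'F_13) != 0 by [].
  have n4 : (4 : 'F_13) != 0 by [].
  by rewrite fab; field; rewrite a0.
have [d1 [d2 [d1A d2A d12]]] : exists d1 d2, [/\ d1 \in A, d2 \in A & d1 != d2].
  by apply/card_gt1P; rewrite A4.
have [a1 [m1 [k1 [a10 f1]]]] := center d1 d1A.
have [a2 [m2 [k2 [a20 f2]]]] := center d2 d2A.
have [p0 p1 p2] := exists_point m1 m2 d12.
(* The odd part of each summand about p0; those of d1 and d2 vanish by the
   choice of p0, so the relation between odd parts involves two forms only. *)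
pose g d u := f d (form d p0 + u) - f d (form d p0 - u).
have g0 d u : d \in A -> g d u = 0.
  move=> dA; rewrite /g.
  have [->|dd1] := eqVneq d d1; first by rewrite p1 !f1; ring.
  have [->|dd2] := eqVneq d d2; first by rewrite p2 !f2; ring.
  have d2A1 : d2 \in A :\ d1 by rewrite !inE eq_sym d12.
  have dA12 : d \in A :\ d1 :\ d2 by rewrite !inE dd1 dd2.
  have g1 v : g d1 v = 0 by rewrite /g p1 !f1; ring.
  have g2 v : g d2 v = 0 by rewrite /g p2 !f2; ring.
  rewrite -/(g d u) (@diff0_const (g d)); first by rewrite /g subr0 addr0 subrr.
  move=> t; change (iter 1%N diff (g d) t = 0).
  have A1 : #|A :\ d1 :\ d2 :\ d| = 1%N.
    move: A4; rewrite (cardsD1 d1) d1A (cardsD1 d2) d2A1 (cardsD1 d) dA12.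
    by case.
  apply: (iter_diff_ridge (d := d) (g := g) A1) => [|v];
    first by rewrite !inE eqxx.
  transitivity (\sum_(e in A) g e (form e v)).
    rewrite (big_setD1 d1 d1A) (big_setD1 d2 d2A1) (big_setD1 d dA12) /=.
    by rewrite g1 g2 !add0r.
  rewrite /g sumrB.
  have := sum12 (p0 + v); rewrite -[RHS](sum12 (p0 - v)).
  under eq_bigr do rewrite formD.
  under [in X in _ = X -> _]eq_bigr do rewrite formD formN.
  by rewrite /f => ->; rewrite subrr.
(* As g d vanishes, p0 lies on the axis of every direction of A. *)
have val48 d : d \in A -> f d (form d p0) = 4 \/ f d (form d p0) = 8.
  move=> dA; have [a [m [k [a0 fm]]]] := center d dA.
  have -> : form d p0 = m.
    have := g0 d 1 dA; rewrite /g !fm => E.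
    have /eqP : 4 * a * (form d p0 - m) = 0 by rewrite -E; ring.
    by rewrite !mulf_eq0 (negbTE a0) subr_eq0 => /= /eqP.
  rewrite fm subrr expr0n mulr0 add0r.
  apply: (quadratic_constant_term a0).
  apply: leq_trans (f52 d dA); rewrite leq_eqVlt; apply/orP; left; apply/eqP.
  rewrite [RHS](reindex_inj (addIr m)) /=; apply: eq_bigr => t _.
  by rewrite fm addrK.
pose j := #|[set d in A | f d (form d p0) == 8]|.
have jle : (j <= 4)%N.
  by rewrite -A4 subset_leq_card //; apply/subsetP => d; rewrite inE => /andP[].
(* With j of the values equal to 8, the sum at p0 is 16 + 4 j. *)
have : (4 * (4 + j))%:R = 12 :> 'F_13.
  rewrite -(sum12 p0) mulnDr natrD.
  transitivity (\sum_(d in A) (4 + 4 *+ (f d (form d p0) == 8)) : 'F_13).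
    rewrite big_split /= sumr_const A4 sumrMnr.
    congr (_ + _); first exact: val_inj.
    rewrite natrM mulr_natr; congr (_ *+ _).
    transitivity (\sum_(d in A | (f d (form d p0) == 8)%R) 1)%N.
      by rewrite /j -sum1_card; apply: eq_bigl => d; rewrite inE.
    by rewrite big_mkcondr; apply: eq_bigr => d _; case: eqP.
  apply: eq_bigr => d dA; rewrite -/(f _ _).
  by case: (val48 d dA) => ->; apply: val_inj; vm_compute.
have chk : all (fun i => (4 * (4 + i))%:R != 12 :> 'F_13) (iota 0 5).
  by vm_compute.
by apply/eqP; move/allP: chk; apply; rewrite mem_iota.
Qed.

(** * Counting points on lines *)

Section Counting.

Variable S : {set plane}.

Lemma in_line d c (p : plane) : (p \in line d c) = (form d p == c).
Proof. by case: d => [m|]; rewrite inE. Qed.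

Lemma sum_line_counts d : (\sum_c #|S :&: line d c| = #|S|)%N.
Proof.
rewrite -[RHS]sum1_card (partition_big (form d) predT) //=.
apply: eq_bigr => c _; rewrite -sum1_card; apply: eq_bigl => p.
by rewrite inE in_line.
Qed.

(** Each point of the set other than [p] lies on one line through [p]; the
    point [p] lies on all fourteen. *)
Lemma sum_counts_through (p : plane) :
  (\sum_d #|S :&: line d (form d p)| = #|S| + 13 * (p \in S))%N.
Proof.
transitivity (\sum_(s in S) #|[set d | form d s == form d p]|)%N.
  transitivity (\sum_d \sum_(s in S | form d s == form d p) 1)%N.
    apply: eq_bigr => d _; rewrite -sum1_card; apply: eq_bigl => s.
    by rewrite inE in_line.
  rewrite (exchange_big_dep (mem S)) /=; last by move=> d s _ /andP[].
  apply: eq_bigr => s sS; rewrite -sum1_card; apply: eq_bigl => d.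
  by rewrite inE sS.
transitivity (\sum_(s in S) (1 + 13 * (s == p)))%N.
  apply: eq_bigr => s _; rewrite card_joining_directions card_Fp //.
  by case: (s == p).
rewrite big_split /= sum1_card -big_distrr /=; congr (_ + 13 * _)%N.
case pS: (p \in S).
  by rewrite (bigD1 p) //= eqxx big1 // => s /andP[_ /negbTE ->].
by rewrite big1 // => s sS; case: eqP sS pS => // -> ->.
Qed.

Lemma card_line_le d c : (#|S :&: line d c| <= 13)%N.
Proof.
(* A form in another direction is injective on the line. *)
have [e de] := exists_other_direction d.
rewrite -(card_in_imset (f := form e)) => [|s t].
  by apply: leq_trans (max_card _) _; rewrite card_Fp.
rewrite !inE !in_line => /andP[_ /eqP sc] /andP[_ /eqP tc].
by apply: form_inj de _; rewrite sc tc.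
Qed.

(** Special directions are counted as classes of lines; injectivity lets them
    be counted by their slopes. A line meets every line of another direction,
    so it cannot coincide with one of them. *)
Lemma parallel_class_inj : injective parallel_class.
Proof.
move=> d e E; apply/eqP/negPn/negP => de.
have /imsetP[c _ E0] : line d 0 \in parallel_class e.
  by rewrite -E; apply: imset_f.
have [p dp ep] := exists_point 0 (c + 1) de.
have : p \in line d 0 by rewrite in_line dp.
by rewrite E0 in_line ep -subr_eq0 addrC addKr.
Qed.

Lemma not_specialP d :
  reflect (forall c c', #|S :&: line d c| = #|S :&: line d c'|)
          (~~ special S (parallel_class d)).
Proof.
rewrite negbK; apply: (iffP idP) => [H c c'|H].
  have cl x : line d x \in parallel_class d by apply: imset_f.
  by move/forall_inP/(_ _ (cl c))/forall_inP/(_ _ (cl c'))/eqP: H.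
apply/forall_inP => _ /imsetP[c _ ->]; apply/forall_inP => _ /imsetP[c' _ ->].
exact/eqP.
Qed.

End Counting.

Local Close Scope ring_scope.

Theorem theorem1p1 :
  ~ exists S : {set plane}, #|S| = 52 /\ #|special_directions S| = 4.
Proof.
case=> S [S52 sp4].
pose A := [set d | special S (parallel_class d)].
have A4 : #|A| = 4%N.
  rewrite -(card_imset _ parallel_class_inj); apply: etrans sp4.
  apply: eq_card => D.
  apply/imsetP/setIdP => [[d + ->]|[/imsetP[d _ ->] spd]].
    by rewrite inE => spd; split=> //; apply: imset_f.
  by exists d; rewrite ?inE.
apply: (@no_four_profiles A (fun d c => #|S :&: line d c|)) => //.
- by move=> d _; rewrite sum_line_counts.
- by move=> d c _; apply: card_line_le.
- by move=> d; rewrite inE => spd H; case/negP: (introT (not_specialP S d) H).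
move=> p.
have out d : d \notin A -> #|S :&: line d (form d p)| = 4%N.
  rewrite inE => /not_specialP H.
  apply/eqP; rewrite -(eqn_pmul2l (m := 13)) //; apply/eqP.
  apply: etrans S52; rewrite -(sum_line_counts S d).
  under eq_bigr => c _ do rewrite (H c (form d p)).
  by rewrite sum_nat_const card_Fp.
have : (\sum_(d in A) #|S :&: line d (form d p)| = 12 + 13 * (p \in S))%N.
  apply/eqP; rewrite -(eqn_add2r 40).
  have := sum_counts_through S p; rewrite (bigID (mem A)) /= S52.
  rewrite [X in (_ + X)%N](eq_bigr (fun=> 4)) // sum_nat_const.
  have -> : #|[predC A]| = 10%N.
    by have := cardC A; rewrite A4 card_option card_Fp // => -[].
  by move=> ->; rewrite addnAC.
move=> /(congr1 (fun k => k%:R : 'F_13)%R); rewrite natr_sum => ->.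
by rewrite natrD natrM pchar_Fp_0 // mul0r addr0.
Qed.
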